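(* Fix any $\tau>0$, $\lambda>0$, $\rho>0$, $a>1$, $\sigma\in(0,1]$ and $0<\gamma<\sigma/2$. Then $S_{\tau,g_{\lambda}}\subseteq\mathrm{crit}\,F_{\sigma,\gamma}$ and $S_{\tau,h_{\lambda,\rho}}\subseteq\mathrm{crit}\,G_{\sigma,\gamma,\rho}$.
   Context: $\mathcal{S}=\{x\in\mathbb{R}^n:\|x\|=1\}$; $\delta_{\mathcal{S}}$ is its indicator function ($0$ on $\mathcal{S}$, $+\infty$ elsewhere); $\|x\|_0$ is the number of nonzero entries of $x$. $A\in\mathbb{R}^{m\times n}$ is a given matrix ($A=\mathrm{Diag}(b)\Phi$ with $b\in\{-1,1\}^m$, $\Phi\in\mathbb{R}^{m\times n}$), and $f_{\sigma,\gamma}(x):=\sum_{i=1}^m\vartheta_{\sigma,\gamma}((Ax)_i)$, where $$\vartheta_{\sigma,\gamma}(t)=\begin{cases}0 & t>0,\\ t^2/(2\gamma) & -\gamma<t\le 0,\\ -t-\gamma/2 & -\sigma+\gamma<t\le-\gamma,\\ \sigma-\frac{\gamma}{2}-\frac{(t+\sigma+\gamma)^2}{4\gamma} & -(\sigma+\gamma)\le t\le\gamma-\sigma,\\ \sigma-\gamma/2 & t<-(\sigma+\gamma).\end{cases}$$ Let $$\psi^*(\omega)=\begin{cases}0 & \omega\le\frac{2}{a+1},\\ \frac{((a+1)\omega-2)^2}{4(a^2-1)} & \frac{2}{a+1}<\omega\le\frac{2a}{a+1},\\ \omega-1 & \omega>\frac{2a}{a+1}.\end{cases}$$ Define $g_{\lambda}(x):=\delta_{\mathcal{S}}(x)+\lambda\|x\|_0$,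 $F_{\sigma,\gamma}:=f_{\sigma,\gamma}+g_{\lambda}$, $\Xi_{\sigma,\gamma}(x):=f_{\sigma,\gamma}(x)-\lambda\sum_{i=1}^n\psi^*(\rho|x_i|)$, $h_{\lambda,\rho}(x):=\delta_{\mathcal{S}}(x)+\lambda\rho\|x\|_1$, $G_{\sigma,\gamma,\rho}:=\Xi_{\sigma,\gamma}+h_{\lambda,\rho}$. Both $f_{\sigma,\gamma}$ and $\Xi_{\sigma,\gamma}$ are continuously differentiable. For a proper lower semicontinuous $h$ and $\tau>0$, $\mathcal{P}_{\tau}h(x):=\arg\min_{z\in\mathbb{R}^n}\{\frac{1}{2\tau}\|z-x\|^2+h(z)\}$ (set-valued). The sets of $\tau$-stationary points are $S_{\tau,g_{\lambda}}=\{x: x\in\mathcal{P}_{\tau}g_{\lambda}(x-\tau\nabla f_{\sigma,\gamma}(x))\}$ and $S_{\tau,h_{\lambda,\rho}}=\{x: x\in\mathcal{P}_{\tau}h_{\lambda,\rho}(x-\tau\nabla\Xi_{\sigma,\gamma}(x))\}$. $\mathrm{crit}\,h=\{x:0\in\partial h(x)\}$ with $\partial h$ the limiting (Mordukhovich) subdifferential. *)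

(* Defs.v *)
From mathcomp Require Import all_boot all_order all_algebra.
From mathcomp Require Import all_classical all_reals all_analysis.
Import Order.TTheory GRing.Theory Num.Theory.
Import numFieldNormedType.Exports.

Set Implicit Arguments.
Unset Strict Implicit.
Unset Printing Implicit Defensive.

Local Open Scope classical_set_scope.
Local Open Scope ring_scope.

(* The library norm on matrices is the sup norm; it is used below only through
   the topology it induces, which is the usual one on R^n.  *)
Section EuclideanSpace.
Context {R : realType} {n : nat}.
Implicit Types (x v w : 'cV[R]_n).

Definition dotv v w : R := \sum_(i < n) v i 0 * w i 0.

Definition enorm x : R := Num.sqrt (\sum_(i < n) x i 0 ^+ 2).

Definition norm1 x : R := \sum_(i < n) `|x i 0|.

Definition norm0 x : nat := #|[pred i : 'I_n | x i 0 != 0]|.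

Definition sphere : set 'cV[R]_n := [set x | enorm x = 1].

Definition gradient (f : 'cV[R]_n -> R) x : 'cV[R]_n :=
  \col_(i < n) 'D_(delta_mx i 0) f x.

End EuclideanSpace.

Section VariationalAnalysis.
Context {R : realType} {n : nat}.
Implicit Types (h : 'cV[R]_n -> \bar R) (x v z : 'cV[R]_n) (C : set 'cV[R]_n).
Local Open Scope ereal_scope.

Definition indicator_fun C x : \bar R := if x \in C then 0 else +oo.

(* As usual in variational analysis, the constant function +oo has no
   minimizer. *)
Definition argmin h : set 'cV[R]_n :=
  [set z | h z < +oo /\ forall w, h z <= h w].

Definition prox (tau : R) h x : set 'cV[R]_n :=
  argmin (fun z => ((2 * tau)^-1 * enorm (z - x)%R ^+ 2)%R%:E + h z).

(* Regular (Frechet) subdifferential. *)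
Definition regular_subdiff h x : set 'cV[R]_n :=
  [set v | h x \is a fin_num /\
    0 <= limf_einf (fun z => (h z - h x - (dotv v (z - x)%R)%:E)
                             * ((enorm (z - x)%R)^-1)%R%:E) x^'].

Definition limiting_subdiff h x : set 'cV[R]_n :=
  [set v | h x \is a fin_num /\
    exists u w : nat -> 'cV[R]_n,
      [/\ u k @[k --> \oo] --> x,
          h (u k) @[k --> \oo] --> h x,
          (forall k, regular_subdiff h (u k) (w k)) &
          w k @[k --> \oo] --> v]].

Definition crit h : set 'cV[R]_n := [set x | limiting_subdiff h x 0%R].

(* tau-stationary points of the composite function f + h, f being smooth. *)
Definition stationary (tau : R) (f : 'cV[R]_n -> R) h : set 'cV[R]_n :=
  [set x | prox tau h (x - tau *: gradient f x)%R x].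

End VariationalAnalysis.

Section Model.
Context {R : realType}.
Implicit Types (sigma gamma lambda rho a : R).

Definition vartheta sigma gamma (t : R) : R :=
  if 0 < t then 0
  else if - gamma < t then t ^+ 2 / (2 * gamma)
  else if - sigma + gamma < t then - t - gamma / 2
  else if - (sigma + gamma) <= t then
    sigma - gamma / 2 - (t + sigma + gamma) ^+ 2 / (4 * gamma)
  else sigma - gamma / 2.

Definition psi_star a (omega : R) : R :=
  if omega <= 2 / (a + 1) then 0
  else if omega <= 2 * a / (a + 1) then
    ((a + 1) * omega - 2) ^+ 2 / (4 * (a ^+ 2 - 1))
  else omega - 1.

Context {m n : nat}.
Implicit Types (A : 'M[R]_(m, n)) (x : 'cV[R]_n).

Definition f_loss A sigma gamma x : R :=
  \sum_(i < m) vartheta sigma gamma ((A *m x) i 0).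

Definition Xi A sigma gamma lambda rho a x : R :=
  f_loss A sigma gamma x - lambda * \sum_(i < n) psi_star a (rho * `|x i 0|).

Definition g_zero lambda x : \bar R :=
  (indicator_fun sphere x + (lambda * (norm0 x)%:R)%:E)%E.

Definition h_one lambda rho x : \bar R :=
  (indicator_fun sphere x + (lambda * rho * norm1 x)%:E)%E.

Definition F_obj A sigma gamma lambda x : \bar R :=
  ((f_loss A sigma gamma x)%:E + g_zero lambda x)%E.

Definition G_obj A sigma gamma lambda rho a x : \bar R :=
  ((Xi A sigma gamma lambda rho a x)%:E + h_one lambda rho x)%E.

End Model.

(* Main.v *)
Require Import Defs.
From mathcomp Require Import all_boot all_order all_algebra.
From mathcomp Require Import all_classical all_reals all_analysis.
From mathcomp Require Import ring lra.
Import Order.TTheory GRing.Theory Num.Theory.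
Import numFieldNormedType.Exports.

(** Both inclusions are instances of one sum rule, [stationary_crit]: let [f] be
    smooth, let [h] never take the value [-oo], and let [x] minimize
    [z |-> |z - (x - tau g)|^2 / (2 tau) + h z] with [g] the gradient of [f] at
    [x].  Expanding the square, minimality says
      [h z >= h x - <g, z - x> - |z - x|^2 / (2 tau)]  for all [z].
    If moreover [f z >= f x + <g, z - x> - C |z - x|^2], the linear terms cancel
    in the sum and [f + h] is minorized near [x] by its value at [x] minus a
    multiple of [|z - x|^2].  Hence [0] is a regular subgradient of [f + h] at
    [x], so a limiting one, as constant sequences show.

    It remains to see that the two smooth parts have such quadratic
    expansions, and that the linear part of the expansion is given by the
    partial derivatives ([quad_approx_gradient]).  Functions with a quadratic
    expansion at every point are closed under linear combinations and contain
    [z |-> max(<w, z> + c, 0)^2] ([quad_smooth_ramp2]).  This suffices: a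
    continuously differentiable function that is piecewise quadratic, such as
    [vartheta] or [psi_star], is up to an affine function a combination of
    squared ramps, one for each breakpoint of its second derivative
    ([varthetaE], [psi_starE]). *)

Set Implicit Arguments.
Unset Strict Implicit.
Unset Printing Implicit Defensive.

Local Open Scope classical_set_scope.
Local Open Scope ring_scope.

(** * Euclidean norm and inner product *)

Section EuclideanNorm.
Context {R : realType} {n : nat}.
Implicit Types (v w x z : 'cV[R]_n).

Lemma enorm_ge0 v : 0 <= enorm v.
Proof. exact: sqrtr_ge0. Qed.

Lemma sqr_enorm v : enorm v ^+ 2 = dotv v v.
Proof.
rewrite /enorm sqr_sqrtr; first by apply: eq_bigr => i _; rewrite expr2.
by apply: sumr_ge0 => i _; exact: sqr_ge0.
Qed.

Lemma sqr_enormD v w :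
  enorm (v + w) ^+ 2 = enorm v ^+ 2 + 2 * dotv v w + enorm w ^+ 2.
Proof.
rewrite !sqr_enorm /dotv mulr_sumr -!big_split /=.
by apply: eq_bigr => i _; rewrite !mxE; ring.
Qed.

Lemma dotvDl v w x : dotv (v + w) x = dotv v x + dotv w x.
Proof. by rewrite -big_split; apply: eq_bigr => i _; rewrite mxE mulrDl. Qed.

Lemma dotvZl k v x : dotv (k *: v) x = k * dotv v x.
Proof. by rewrite mulr_sumr; apply: eq_bigr => i _; rewrite mxE mulrA. Qed.

Lemma dotvC v w : dotv v w = dotv w v.
Proof. by apply: eq_bigr => i _; rewrite mulrC. Qed.

Lemma dotvZr k v x : dotv v (k *: x) = k * dotv v x.
Proof. by rewrite dotvC dotvZl dotvC. Qed.

Lemma dotvBr v x z : dotv v (z - x) = dotv v z - dotv v x.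
Proof. by rewrite dotvC dotvDl -scaleN1r dotvZl mulN1r !(dotvC v). Qed.

Lemma dot0v v : dotv 0 v = 0.
Proof. by apply: big1 => i _; rewrite mxE mul0r. Qed.

Lemma dotv_delta v i : dotv v (delta_mx i 0) = v i 0.
Proof.
rewrite /dotv (bigD1 i) //= mxE !eqxx mulr1 big1 ?addr0 // => j ji.
by rewrite mxE (negPf ji) mulr0.
Qed.

Lemma abs_coord_le_enorm v i : `|v i 0| <= enorm v.
Proof.
rewrite -sqrtr_sqr; apply: ler_wsqrtr; rewrite (bigD1 i) //= lerDl.
by apply: sumr_ge0 => j _; exact: sqr_ge0.
Qed.

(** A crude substitute for the Cauchy-Schwarz inequality: only the linear
    dependence on [enorm v] matters below. *)
Lemma abs_dotv_le v w : `|dotv w v| <= norm1 w * enorm v.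
Proof.
apply: le_trans (ler_norm_sum _ _ _) _; rewrite mulr_suml; apply: ler_sum => i _.
by rewrite normrM ler_wpM2l // abs_coord_le_enorm.
Qed.

(** Compares the Euclidean norm, in which the expansions are written, with the
    topology of the matrix space, in which the limits are taken. *)
Lemma enorm_dist_cvg0 x : enorm (z - x) @[z --> x] --> (0 : R).
Proof.
have -> : (0 : R) = Num.sqrt (\sum_(i < n) (x i 0 - x i 0) ^+ 2).
  by rewrite big1 ?sqrtr0 // => i _; rewrite subrr expr0n.
(* Naming the filter avoids the unfolding of the neighbourhoods of a matrix
   into products, which would hide the filter instance. *)
apply: (@cvg_comp _ _ _ (fun z => \sum_(i < n) (z - x) i 0 ^+ 2) Num.sqrt);
  last exact: sqrt_continuous.
apply: (@cvg_big _ _ _ _ _ add_continuous _ _ _ _ _ (nbhs_filter x)) => i _.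
under eq_fun do rewrite !mxE expr2.
have h : z i 0 - x i 0 @[z --> x] --> x i 0 - x i 0.
  by apply: (@cvgB _ _ _ _ (nbhs_filter x)); [exact: coord_continuous | exact: cvg_cst].
by rewrite expr2; exact: (@cvgM _ _ _ (nbhs_filter x)).
Qed.

End EuclideanNorm.

(** * Quadratic expansions *)

Section QuadraticApproximation.
Context {R : realType} {n : nat}.
Implicit Types (F G : 'cV[R]_n -> R) (x z g : 'cV[R]_n).

(** First-order expansion with a remainder of second order, as holds for
    functions with Lipschitz gradient.  The bound is global in [z], which spares
    any localization. *)
Definition quad_approx F x g :=
  exists C, forall z, `|F z - F x - dotv g (z - x)| <= C * enorm (z - x) ^+ 2.

(** Along a coordinate direction the difference quotient of step [t] is within
    [C |t|] of the corresponding entry of [g]. *)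
Lemma quad_approx_gradient F x g : quad_approx F x g -> gradient F x = g.
Proof.
move=> [C FC]; apply/matrixP => i j; rewrite ord1 mxE.
apply: cvg_lim => //; apply/cvgrPdist_le => /= e e0.
(* The bound on [t] divides by [|C| + 1], since [C] may vanish. *)
have C1 : 0 < `|C| + 1 by apply: ltr_wpDl.
near=> t.
have t0 : t != 0 by near: t; exact: nbhs_dnbhs_neq.
have := FC (t *: delta_mx i 0 + x).
rewrite addrK dotvZr dotv_delta sqr_enorm dotvZr dotvC dotvZr dotv_delta !mxE !eqxx mulr1.
move=> FCt.
have -> : g i 0 - t^-1 *: (F (t *: delta_mx i 0 + x) - F x) =
  - (t^-1 * (F (t *: delta_mx i 0 + x) - F x - t * g i 0)).
  by rewrite mulrBr mulrA mulVf // mul1r opprB.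
rewrite normrN normrM normfV mulrC ler_pdivrMr ?normr_gt0 //.
apply: (le_trans FCt).
have -> : t * t = `|t| * `|t| by rewrite -normrM ger0_norm // -expr2 sqr_ge0.
rewrite mulrA ler_wpM2r //.
have te : `|t| <= e / (`|C| + 1).
  by near: t; apply: dnbhs0_le; exact: divr_gt0.
apply: (@le_trans _ _ ((`|C| + 1) * `|t|)).
  rewrite ler_wpM2r // (le_trans (ler_norm C)) // lerDl //.
by rewrite mulrC -ler_pdivlMr.
Unshelve. all: end_near.
Qed.

Lemma quad_approx_cst c x : quad_approx (fun=> c) x 0.
Proof. by exists 0 => z; rewrite dot0v subrr subr0 normr0 mul0r. Qed.

Lemma quad_approxD F G x g h : quad_approx F x g -> quad_approx G x h ->
  quad_approx (fun z => F z + G z) x (g + h).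
Proof.
move=> [C FC] [D GD]; exists (C + D) => z; rewrite dotvDl mulrDl.
have -> : F z + G z - (F x + G x) - (dotv g (z - x) + dotv h (z - x)) =
  (F z - F x - dotv g (z - x)) + (G z - G x - dotv h (z - x)) by ring.
exact: le_trans (ler_normD _ _) (lerD (FC z) (GD z)).
Qed.

Lemma quad_approxZ k F x g : quad_approx F x g ->
  quad_approx (fun z => k * F z) x (k *: g).
Proof.
move=> [C FC]; exists (`|k| * C) => z; rewrite dotvZl -!mulrBr normrM -mulrA.
exact: ler_wpM2l.
Qed.

Definition quad_smooth F := forall x, exists g, quad_approx F x g.

Lemma quad_smooth_cst c : quad_smooth (fun=> c).
Proof. by move=> x; exists 0; exact: quad_approx_cst. Qed.

Lemma quad_smoothD F G : quad_smooth F -> quad_smooth G ->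
  quad_smooth (fun z => F z + G z).
Proof.
by move=> hF hG x; have [g ?] := hF x; have [h ?] := hG x;
  exists (g + h); exact: quad_approxD.
Qed.

Lemma quad_smoothZ k F : quad_smooth F -> quad_smooth (fun z => k * F z).
Proof. by move=> hF x; have [g ?] := hF x; exists (k *: g); exact: quad_approxZ. Qed.

Lemma quad_smoothB F G : quad_smooth F -> quad_smooth G ->
  quad_smooth (fun z => F z - G z).
Proof.
move=> hF hG; have -> : (fun z => F z - G z) = (fun z => F z + -1 * G z).
  by apply/funext => z; rewrite mulN1r.
exact/quad_smoothD/quad_smoothZ.
Qed.

Lemma quad_smooth_sum (I : Type) (r : seq I) (F : I -> 'cV[R]_n -> R) :
  (forall i, quad_smooth (F i)) -> quad_smooth (fun z => \sum_(i <- r) F i z).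
Proof.
move=> hF; elim: r => [|i r ih].
  by under eq_fun do rewrite big_nil; exact: quad_smooth_cst.
by under eq_fun do rewrite big_cons; exact: quad_smoothD.
Qed.

End QuadraticApproximation.

(** * Squared ramps and the two piecewise quadratic functions *)

Section SquaredRamp.
Context {R : realType}.
Implicit Types (s t c : R).

Definition ramp2 t : R := Num.max t 0 ^+ 2.

Lemma ramp2_ge0 t : 0 <= t -> ramp2 t = t ^+ 2.
Proof. by rewrite /ramp2 => /max_idPl ->. Qed.

Lemma ramp2_le0 t : t <= 0 -> ramp2 t = 0.
Proof. by rewrite /ramp2 => /max_idPr ->; rewrite expr0n. Qed.

(** The derivative [2 max(t, 0)] of the squared ramp is 2-Lipschitz. *)
Lemma ramp2_taylor s t :
  `|ramp2 s - ramp2 t - 2 * Num.max t 0 * (s - t)| <= (s - t) ^+ 2.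
Proof.
have st2 := sqr_ge0 (s - t); rewrite ler_norml /ramp2.
case: (leP t 0) => t0; case: (leP s 0) => s0;
  by apply/andP; split; nra.
Qed.

Lemma quad_smooth_ramp2 (n : nat) (w : 'cV[R]_n) c :
  quad_smooth (fun z => ramp2 (dotv w z + c)).
Proof.
move=> x; exists ((2 * Num.max (dotv w x + c) 0) *: w), (norm1 w ^+ 2) => z.
rewrite dotvZl dotvBr -exprMn.
have -> : dotv w z - dotv w x = dotv w z + c - (dotv w x + c) by ring.
apply: (le_trans (ramp2_taylor _ _)).
have -> : dotv w z + c - (dotv w x + c) = dotv w (z - x) by rewrite dotvBr; ring.
rewrite -real_normK ?num_real // lerXn2r ?nnegrE ?abs_dotv_le //.
by apply: mulr_ge0; rewrite ?enorm_ge0 // sumr_ge0.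
Qed.

(* Evaluates each squared ramp whose argument has a sign that follows from the
   context by linear arithmetic. *)
Ltac eval_ramp2 := repeat match goal with |- context [ramp2 ?t] =>
  first [ have -> : ramp2 t = 0 by apply: ramp2_le0; lra
        | have -> : ramp2 t = t ^+ 2 by apply: ramp2_ge0; lra ] end.

(** The second derivative of [vartheta] is [1/gamma] on [(-gamma, 0)],
    [-1/(2 gamma)] on [(-sigma-gamma, -sigma+gamma)] and [0] elsewhere.  Each
    jump contributes a squared ramp; these open to the left because [vartheta]
    vanishes on the right. *)
Lemma varthetaE sigma gamma t : 0 < gamma < sigma / 2 ->
  vartheta sigma gamma t =
    (2 * gamma)^-1 * (ramp2 (- t) - ramp2 (- t - gamma))
    - (4 * gamma)^-1 *
      (ramp2 (- t - sigma + gamma) - ramp2 (- t - sigma - gamma)).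
Proof.
move=> /andP[g0 gs]; have gN0 : gamma != 0 by rewrite gt_eqF.
rewrite /vartheta; case: ltP => [t1|t1]; first by eval_ramp2; field.
case: ltP => [t2|t2]; first by eval_ramp2; field.
case: ltP => [t3|t3]; first by eval_ramp2; field.
by case: leP => [t4|t4]; eval_ramp2; field.
Qed.

(** Here the second derivative is constant between the two thresholds and [0]
    elsewhere. *)
Lemma psi_starE a u : 1 < a ->
  psi_star a u = (a + 1) / (4 * (a - 1)) *
    (ramp2 (u - 2 / (a + 1)) - ramp2 (u - 2 * a / (a + 1))).
Proof.
move=> a1; have aD0 : a + 1 != 0 by apply/eqP; lra.
have aB0 : a - 1 != 0 by apply/eqP; lra.
have aS0 : a ^+ 2 - 1 != 0 by apply/eqP; nra.
have c12 : 2 / (a + 1) < 2 * a / (a + 1) by rewrite ltr_pM2r ?invr_gt0; lra.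
rewrite /psi_star; case: leP => u1; first by eval_ramp2; ring.
by case: leP => u2; eval_ramp2; field; rewrite ?aD0 ?aB0 ?aS0.
Qed.

(** For a positive threshold the kink of the absolute value at [0] lies in the
    flat part of the ramp, so that composition with it stays smooth. *)
Lemma ramp2_abs k c t : 0 < k -> 0 < c ->
  ramp2 (k * `|t| - c) = ramp2 (k * t - c) + ramp2 (- k * t - c).
Proof.
move=> k0 c0; have [t0|t0] := leP 0 t.
  have kt : 0 <= k * t by apply: mulr_ge0 => //; exact: ltW.
  by rewrite ger0_norm // [ramp2 (- k * t - c)]ramp2_le0 ?addr0 //; lra.
have kt : k * t <= 0 by rewrite pmulr_rle0 // ltW.
by rewrite ltr0_norm // [ramp2 (k * t - c)]ramp2_le0 ?mulrN ?mulNr ?add0r //; lra.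
Qed.

End SquaredRamp.

(** * Stationary points are critical *)

Section StationaryPoints.
Context {R : realType} {n : nat}.
Implicit Types (f : 'cV[R]_n -> R) (h : 'cV[R]_n -> \bar R) (x : 'cV[R]_n).

(** The difference quotient in the definition of a regular subgradient is at
    least [- K |z - x|], which tends to [0]. *)
Lemma regular_subdiff0 h x K : h x \is a fin_num ->
    (forall z, h x - (K * enorm (z - x) ^+ 2)%:E <= h z)%E ->
  regular_subdiff h x 0.
Proof.
move=> hx hK; split => //.
apply/lee_addgt0Pr => e e0.
have [r hr] : exists r, h x = r%:E by exists (fine (h x)); rewrite fineK.
pose A := [set z | K * enorm (z - x) <= e].
have Ax : x^' A.
  apply: nbhs_dnbhs.
  have : K * enorm (z - x) @[z --> x] --> K * 0.
    apply: (@cvgM _ _ _ (nbhs_filter x) (fun=> K)); last exact: enorm_dist_cvg0.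
    exact: (@cvg_cst _ _ _ _ (nbhs_filter x)).
  by rewrite mulr0 => /(@cvgr_le _ _ _ (nbhs_filter x)); exact.
have -> : 0%E = ((- e)%:E + e%:E)%E by rewrite -EFinD addNr.
apply: leeD2r; rewrite limf_einfE.
apply: (@le_trans _ _ (ereal_inf
  [set ((h z - h x - (dotv 0 (z - x))%:E) * (enorm (z - x))^-1%:E)%E | z in A])).
  apply: le_ereal_inf_tmp => _ [z Az <-].
  have := hK z; rewrite hr dot0v sube0.
  have e1 : 0 <= (enorm (z - x))^-1 by rewrite invr_ge0 enorm_ge0.
  case: (h z) => [s| |] /=.
  - rewrite -EFinB -EFinM !lee_fin => hs.
    have : - (K * enorm (z - x) ^+ 2) * (enorm (z - x))^-1
             <= (s - r) * (enorm (z - x))^-1 by apply: ler_wpM2r => //; lra.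
    apply: le_trans; rewrite mulNr lerN2; apply: le_trans Az.
    (* At norm zero the inverse is zero and both sides vanish. *)
    have [->|zx] := eqVneq (enorm (z - x)) 0; first by rewrite invr0 !mulr0.
    by rewrite expr2 mulrA mulfK.
  - move=> _; apply: (@le_trans _ _ 0%E).
      by rewrite lee_fin oppr_le0 ltW.
    by rewrite addye // mule_ge0 // ?leey // lee_fin.
  - by rewrite -EFinB.
by apply: ereal_sup_ubound; exists A.
Qed.

Lemma regular_sub_limiting h x v : regular_subdiff h x v -> limiting_subdiff h x v.
Proof.
move=> hv; split; first by case: hv.
by exists (fun=> x), (fun=> v); split => //; exact: cvg_cst.
Qed.

(** The linear term coming from the square in the proximal problem cancels the
    linear term of the expansion of [f]. *)
Lemma stationary_crit f h tau x : 0 < tau ->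
    (forall z, h z != -oo%E) -> quad_smooth f ->
  stationary tau f h x -> crit (fun z => (f z)%:E + h z)%E x.
Proof.
move=> tau0 hN fS [].
have [g fg] := fS x; rewrite (quad_approx_gradient fg).
have [C fC] := fg.
case hx : (h x) => [r| |] // _ hmin; last by have := hN x; rewrite hx eqxx.
apply: regular_sub_limiting.
apply: (@regular_subdiff0 _ _ (C + (2 * tau)^-1)); first by rewrite hx.
move=> z; have := hmin z; have := fC z; rewrite hx.
case hz : (h z) => [s| |]; last by have := hN z; rewrite hz eqxx.
  have -> : z - (x - tau *: g) = (z - x) + tau *: g by rewrite opprB addrA addrAC.
  have -> : x - (x - tau *: g) = 0 + tau *: g by rewrite opprB addrCA subrr addr0 add0r.
  rewrite -!EFinD !lee_fin ler_norml; move: (z - x) => d /andP[fz _].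
  rewrite !sqr_enormD !dotvZr dot0v (dotvC _ g) [enorm 0 ^+ 2]sqr_enorm dot0v.
  rewrite !mulr0 !add0r !mulrDr.
  have -> : (2 * tau)^-1 * (2 * (tau * dotv g d)) = dotv g d.
    by field; rewrite gt_eqF.
  by move: (enorm d ^+ 2) ((2 * tau)^-1) fz => q k; lra.
by move=> _ _; rewrite addey // leey.
Qed.

End StationaryPoints.

Lemma quad_smooth_f_loss (R : realType) (m n : nat) (A : 'M[R]_(m, n))
    (sigma gamma : R) : 0 < gamma < sigma / 2 ->
  quad_smooth (f_loss A sigma gamma).
Proof.
move=> hg; apply: quad_smooth_sum => i.
(* The ramps of [vartheta] open to the left: take minus the row of [A]. *)
pose w : 'cV[R]_n := - (row i A)^T.
have wE (z : 'cV[R]_n) : - (A *m z) i 0 = dotv w z.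
  by rewrite mxE -sumrN; apply: eq_bigr => j _; rewrite !mxE mulNr.
under eq_fun do rewrite varthetaE // wE -[dotv w _ in X in ramp2 X]addr0 -!addrA.
by apply: quad_smoothB; apply: quad_smoothZ; apply: quad_smoothB;
  exact: quad_smooth_ramp2.
Qed.

Lemma quad_smooth_Xi (R : realType) (m n : nat) (A : 'M[R]_(m, n))
    (sigma gamma lambda rho a : R) : 0 < gamma < sigma / 2 -> 0 < rho -> 1 < a ->
  quad_smooth (Xi A sigma gamma lambda rho a).
Proof.
move=> hg rho0 a1; apply: quad_smoothB; first exact: quad_smooth_f_loss.
apply/quad_smoothZ/quad_smooth_sum => i.
have wE k (z : 'cV[R]_n) : k * z i 0 = dotv (k *: delta_mx i 0) z.
  by rewrite dotvZl dotvC dotv_delta.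
have c1 : 0 < 2 / (a + 1) by rewrite divr_gt0; lra.
have c2 : 0 < 2 * a / (a + 1) by rewrite divr_gt0; lra.
under eq_fun do rewrite psi_starE // !ramp2_abs // !wE.
by apply/quad_smoothZ/quad_smoothB; apply: quad_smoothD; exact: quad_smooth_ramp2.
Qed.

Theorem lemma2p4 (R : realType) (m n : nat)
    (b : 'rV[R]_m) (Phi A : 'M[R]_(m, n))
    (hb : forall i : 'I_m, b 0 i = 1 \/ b 0 i = -1)
    (hA : A = diag_mx b *m Phi)
    (tau lambda rho a sigma gamma : R)
    (htau : 0 < tau) (hlambda : 0 < lambda) (hrho : 0 < rho) (ha : 1 < a)
    (hsigma : 0 < sigma <= 1) (hgamma : 0 < gamma < sigma / 2) :
  stationary tau (f_loss A sigma gamma) (g_zero lambda)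
    `<=` crit (F_obj A sigma gamma lambda) /\
  stationary tau (Xi A sigma gamma lambda rho a) (h_one lambda rho)
    `<=` crit (G_obj A sigma gamma lambda rho a).
Proof.
split => x; apply: stationary_crit => //.
- by move=> z; rewrite /g_zero /indicator_fun; case: ifP.
- exact: quad_smooth_f_loss.
- by move=> z; rewrite /h_one /indicator_fun; case: ifP.
- exact: quad_smooth_Xi.
Qed.
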